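(* Let $X,Y,P$ be Banach spaces, $F:X\times P\rightrightarrows Y$ and $G:X\rightrightarrows Y$ set-valued maps, and $(\overline{x},\overline{p},\overline{y})\in X\times P\times Y$ such that $\overline{y}\in F(\overline{x},\overline{p})$ and $-\overline{y}\in G(\overline{x})$. Denote $F_p(\cdot):=F(\cdot,p)$ and define $S:P\rightrightarrows X$ by $S(p):=\{x\in X\mid 0\in F(x,p)+G(x)\}$. Suppose that: (i) $(F,G)$ is locally sum-stable around $((\overline{x},\overline{p}),\overline{y},-\overline{y})$; (ii) $\operatorname{Gr}F_p$ is locally closed around $(\overline{x},\overline{y})$ uniformly for $p$ in a neighborhood of $\overline{p}$; (iii) $\operatorname{Gr}G$ is locally closed around $(\overline{x},-\overline{y})$; (iv) $F$ has the Aubin property with respect to $x$, uniformly in $p$, around $((\overline{x},\overline{p}),\overline{y})$; (v) $F$ is calm with respect to $p$, uniformly in $x$, at $((\overline{x},\overline{p}),\overline{y})$; (vi) $G$ is metrically regular around $(\overline{x},-\overline{y})$; (vii) $\widehat{\operatorname{lip}}_xF((\overline{x},\overline{p}),\overline{y})\cdot\operatorname{reg}G(\overline{x},-\overline{y})<1$. Then $S$ is calm at $(\overline{p},\overline{x})$. Moreover, $$\operatorname{clm}S(\overline{p},\overline{x})\leq\frac{\operatorname{reg}G(\overline{x},-\overline{y})\cdot\widehat{\operatorname{clm}}_pF((\overline{x},\overline{p}),\overline{y})}{1-\widehat{\operatorname{lip}}_xF((\overline{x},\overline{p}),\overline{y})\cdot\operatorname{reg}G(\overline{x},-\overline{y}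)}.$$
   Context: $B(x,r)$, $D(x,r)$ are the open and closed balls; $\mathcal{V}(x)$ is the set of neighborhoods of $x$. $d(x,A)=\inf_{a\in A}d(x,a)$ with $d(x,\emptyset)=\infty$; the excess is $e(A,B)=\sup\{d(a,B)\mid a\in A\}$ (with $e(\emptyset,B)=0$). $\operatorname{Gr}T=\{(x,y)\mid y\in T(x)\}$, $T^{-1}(y)=\{x\mid y\in T(x)\}$. Product spaces carry the additive metric. A set $A$ is locally closed around $a\in A$ if $A\cap D(a,r)$ is closed for some $r>0$. Assumption (ii) means: there is $\gamma>0$ such that for every $p\in B(\overline{p},\gamma)$ the set $\operatorname{Gr}F_p\cap[D(\overline{x},\gamma)\times D(\overline{y},\gamma)]$ is closed. $(F,G)$ is locally sum-stable around $((\overline{x},\overline{p}),\overline{y},\overline{z})$ (with $\overline{y}\in F(\overline{x},\overline{p})$, $\overline{z}\in G(\overline{x})$) if for every $\varepsilon>0$ there exists $\delta>0$ such that, for every $(x,p)\in B(\overline{x},\delta)\times B(\overline{p},\delta)$ and every $w\in(F(x,p)+G(x))\cap B(\overline{y}+\overline{z},\delta)$, there exist $y\in F(x,p)\cap B(\overline{y},\varepsilon)$ and $z\in G(x)\cap B(\overline{z},\varepsilon)$ with $w=y+z$. $F$ has the Aubin property with respect to $x$ uniformly in $p$ around $((\overline{x},\overline{p}),\overline{y})$ with constant $L>0$ if there exist $U\in\mathcal{V}(\overline{x})$, $V\in\mathcal{V}(\overline{p})$, $W\in\mathcal{V}(\overline{y})$ such that $e(F_p(x)\cap W,F_p(u))\leq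 L\,d(x,u)$ for all $x,u\in U$, $p\in V$; the infimum of such $L$ is $\widehat{\operatorname{lip}}_xF((\overline{x},\overline{p}),\overline{y})$. $F$ is calm with respect to $p$ uniformly in $x$ at $((\overline{x},\overline{p}),\overline{y})$ with constant $L>0$ if there exist such neighborhoods with $e(F(x,p)\cap W,F(x,\overline{p}))\leq L\,d(p,\overline{p})$ for all $x\in U$, $p\in V$; the infimum of such $L$ is $\widehat{\operatorname{clm}}_pF((\overline{x},\overline{p}),\overline{y})$. For $T:X\rightrightarrows Y$ and $(\overline{x},\overline{y})\in\operatorname{Gr}T$: $T$ is metrically regular around $(\overline{x},\overline{y})$ with constant $L>0$ if there exist $U\in\mathcal{V}(\overline{x})$, $V\in\mathcal{V}(\overline{y})$ with $d(x,T^{-1}(y))\leq L\,d(y,T(x))$ for every $(x,y)\in U\times V$, and $\operatorname{reg}T(\overline{x},\overline{y})$ is the infimum of such $L$; $T$ is calm with constant $L>0$ at $(\overline{x},\overline{y})$ if there exist $U\in\mathcal{V}(\overline{x})$, $V\in\mathcal{V}(\overline{y})$ with $e(T(x)\cap V,T(\overline{x}))\leq L\,d(x,\overline{x})$ for every $x\in U$, and $\operatorname{clm}T(\overline{x},\overline{y})$ is the infimum of such $L$. A property without mention of a constant means that it holds for some $L>0$. *)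

(* Defs.v *)
From HB Require Import structures.
From mathcomp Require Import all_boot all_order all_algebra.
From mathcomp Require Import all_classical all_reals all_analysis.
Set Implicit Arguments.
Unset Strict Implicit.
Unset Printing Implicit Defensive.
Import Order.TTheory GRing.Theory Num.Theory.
Import numFieldNormedType.Exports.

Local Open Scope classical_set_scope.
Local Open Scope ring_scope.

(* A set-valued map from S to T is a function S -> set T. *)

(* Equals +oo when A is empty, since ereal_inf set0 = +oo. *)
Definition dist_set (R : realType) (V : normedModType R) (x : V) (A : set V)
    : \bar R :=
  ereal_inf [set `|x - a|%:E | a in A].

(* The empty case is separate because ereal_sup set0 = -oo. *)
Definition excess (R : realType) (V : normedModType R) (A B : set V) : \bar R :=
  if A == set0 then 0%E else ereal_sup [set dist_set a B | a in A].

Definition graph (S T : Type) (M : S -> set T) : set (S * T) :=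
  [set xy | M xy.1 xy.2].

Definition inverse_map (S T : Type) (M : S -> set T) (y : T) : set S :=
  [set x | M x y].

Definition set_sum (V : zmodType) (A B : set V) : set V :=
  [set a + b | a in A & b in B].

(* D(x, r), for the metric of a normed space. *)
Definition cball (R : realType) (V : normedModType R) (x : V) (r : R) : set V :=
  closed_ball_ (fun v : V => `|v|) x r.

(* The closed ball of X * Y for the additive metric; the norm that the library
   puts on a product is the maximum norm. *)
Definition add_cball (R : realType) (X Y : normedModType R) (a : X * Y) (r : R)
    : set (X * Y) :=
  [set b | `|a.1 - b.1| + `|a.2 - b.2| <= r].

Definition locally_closed_around (R : realType) (X Y : normedModType R)
    (A : set (X * Y)) (a : X * Y) : Prop :=
  exists r : R, 0 < r /\ closed (A `&` add_cball a r).

(* The partial map F_p. *)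
Definition slice (X P Y : Type) (F : X * P -> set Y) (p : P) : X -> set Y :=
  fun x => F (x, p).

Definition locally_closed_graphs_unif (R : realType) (X P Y : normedModType R)
    (F : X * P -> set Y) (xb : X) (pb : P) (yb : Y) : Prop :=
  exists g : R, 0 < g /\
    forall p, ball pb g p ->
      closed (graph (slice F p) `&` (cball xb g `*` cball yb g)).

Definition locally_sum_stable (R : realType) (X P Y : normedModType R)
    (F : X * P -> set Y) (G : X -> set Y) (xb : X) (pb : P) (yb zb : Y) : Prop :=
  forall e : R, 0 < e -> exists d : R, 0 < d /\
    forall x p, ball xb d x -> ball pb d p ->
    forall w, set_sum (F (x, p)) (G x) w -> ball (yb + zb) d w ->
    exists y z, [/\ F (x, p) y, ball yb e y, G x z, ball zb e z & w = y + z].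

Definition aubin_x_const (R : realType) (X P Y : normedModType R)
    (F : X * P -> set Y) (xb : X) (pb : P) (yb : Y) (L : R) : Prop :=
  0 < L /\ exists U V W, [/\ nbhs xb U, nbhs pb V, nbhs yb W &
    forall x u p, U x -> U u -> V p ->
      (excess (slice F p x `&` W) (slice F p u) <= (L * `|x - u|)%:E)%E].

Definition aubin_x (R : realType) (X P Y : normedModType R)
    (F : X * P -> set Y) (xb : X) (pb : P) (yb : Y) : Prop :=
  exists L, aubin_x_const F xb pb yb L.

Definition lip_x (R : realType) (X P Y : normedModType R)
    (F : X * P -> set Y) (xb : X) (pb : P) (yb : Y) : \bar R :=
  ereal_inf [set L%:E | L in aubin_x_const F xb pb yb].

Definition calm_p_const (R : realType) (X P Y : normedModType R)
    (F : X * P -> set Y) (xb : X) (pb : P) (yb : Y) (L : R) : Prop :=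
  0 < L /\ exists U V W, [/\ nbhs xb U, nbhs pb V, nbhs yb W &
    forall x p, U x -> V p ->
      (excess (F (x, p) `&` W) (F (x, pb)) <= (L * `|p - pb|)%:E)%E].

Definition calm_p (R : realType) (X P Y : normedModType R)
    (F : X * P -> set Y) (xb : X) (pb : P) (yb : Y) : Prop :=
  exists L, calm_p_const F xb pb yb L.

Definition clm_p (R : realType) (X P Y : normedModType R)
    (F : X * P -> set Y) (xb : X) (pb : P) (yb : Y) : \bar R :=
  ereal_inf [set L%:E | L in calm_p_const F xb pb yb].

Definition metrically_regular_const (R : realType) (X Y : normedModType R)
    (T : X -> set Y) (xb : X) (yb : Y) (L : R) : Prop :=
  0 < L /\ exists U V, [/\ nbhs xb U, nbhs yb V &
    forall x y, U x -> V y ->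
      (dist_set x (inverse_map T y) <= L%:E * dist_set y (T x))%E].

Definition metrically_regular (R : realType) (X Y : normedModType R)
    (T : X -> set Y) (xb : X) (yb : Y) : Prop :=
  exists L, metrically_regular_const T xb yb L.

Definition reg (R : realType) (X Y : normedModType R)
    (T : X -> set Y) (xb : X) (yb : Y) : \bar R :=
  ereal_inf [set L%:E | L in metrically_regular_const T xb yb].

Definition calm_const (R : realType) (X Y : normedModType R)
    (T : X -> set Y) (xb : X) (yb : Y) (L : R) : Prop :=
  0 < L /\ exists U V, [/\ nbhs xb U, nbhs yb V &
    forall x, U x -> (excess (T x `&` V) (T xb) <= (L * `|x - xb|)%:E)%E].

Definition calm (R : realType) (X Y : normedModType R)
    (T : X -> set Y) (xb : X) (yb : Y) : Prop :=
  exists L, calm_const T xb yb L.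

Definition clm (R : realType) (X Y : normedModType R)
    (T : X -> set Y) (xb : X) (yb : Y) : \bar R :=
  ereal_inf [set L%:E | L in calm_const T xb yb].

Definition solution_map (X P : Type) (Y : zmodType)
    (F : X * P -> set Y) (G : X -> set Y) : P -> set X :=
  fun p => [set x | set_sum (F (x, p)) (G x) 0].

(* Main.v *)
(* Fix p near pb and x in S(p) near xb. Sum-stability writes 0 = y + (- y) with
   y in F(x, p) near yb and - y in G(x); calmness moves y to some z in F(x, pb)
   with |z - y| <= c |p - pb|. A Lyusternik-Graves iteration at the parameter pb
   then corrects x to a point of S(pb) at distance at most
   k / (1 - k l) * |z - y|, where k, l are constants of metric regularity of G
   and of the Aubin property of F. Letting the constants k, l, c decrease to
   their infima gives the bound on clm S. *)
Require Import Defs.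
From HB Require Import structures.
From mathcomp Require Import all_boot all_order all_algebra.
From mathcomp Require Import all_classical all_reals all_analysis.
From mathcomp Require Import ring lra.
Set Implicit Arguments.
Unset Strict Implicit.
Unset Printing Implicit Defensive.
Import Order.TTheory GRing.Theory Num.Theory.
Import numFieldNormedType.Exports.

Local Open Scope classical_set_scope.
Local Open Scope ring_scope.

(** * Lyusternik-Graves iteration in complete spaces *)

(** The telescoping series is dominated in norm by a geometric one, so completeness applies. *)
Lemma cvgn_geometric_step (R : realType) (V : completeNormedModType R)
    (u : V ^nat) (C q : R) :
  0 <= C -> 0 <= q < 1 -> (forall n, `|u n.+1 - u n| <= C * q ^+ n) -> cvgn u.
Proof.
move=> C0 /andP[q0 q1] hu.
have cu : cvgn (series (telescope u)).
  apply: normed_cvg; apply: (@series_le_cvg _ _ (geometric C q)) => //.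
  - by move=> n; exact: normr_ge0.
  - by move=> n; exact: mulr_ge0 (exprn_ge0 n q0).
  - by apply: is_cvg_geometric_series; rewrite ger0_norm.
rewrite (_ : u = (fun n => u 0%N + series (telescope u) n)); last first.
  by apply/funext => n; exact: eq_sum_telescope.
by apply: is_cvgD => //; exact: is_cvg_cst.
Qed.

(* The Lyusternik-Graves iteration: from [y \in - G x] and [z \in F x] go to
   [z \in - G x'] and [z' \in F x'], which shrinks the gap [z - y] by [k * l]. *)
Lemma coincidence_point (R : realType) (X Y : completeNormedModType R)
    (F G : X -> set Y) (xb : X) (yb : Y) (a k l : R) :
  0 < k -> 0 < l -> k * l < 1 ->
  closed (graph F `&` (cball xb a `*` cball yb a)) ->
  closed (graph G `&` (cball xb a `*` cball (- yb) a)) ->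
  (forall x u y, ball xb a x -> ball xb a u -> ball yb a y -> F x y ->
     exists2 y', F u y' & `|y' - y| <= l * `|u - x|) ->
  (forall x y z, ball xb a x -> ball yb a z -> G x (- y) ->
     exists2 u, G u (- z) & `|u - x| <= k * `|z - y|) ->
  forall x y z, F x z -> G x (- y) ->
    `|x - xb| + k / (1 - k * l) * `|z - y| < a ->
    `|z - yb| + k * l / (1 - k * l) * `|z - y| < a ->
  exists u w, [/\ F u w, G u (- w) & `|u - x| <= k / (1 - k * l) * `|z - y|].
Proof.
move=> k0 l0 kl1 clF clG stepF stepG x0 y0 z0 Fz0 Gy0 hx0 hz0.
set q := k * l in kl1 hx0 hz0 *.
have q0 : 0 < q by exact: mulr_gt0.
have q1 : 0 < 1 - q by rewrite subr_gt0.
set K := k / (1 - q) in hx0 *; set Q := q / (1 - q) in hz0.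
have K0 : 0 <= K by rewrite divr_ge0 ?ltW.
have Q0 : 0 <= Q by rewrite divr_ge0 ?ltW.
(* [K] and [Q] are the sums of the geometric series of ratio [q] with first terms [k] and [q]; both
   identities say that one step uses up exactly the first term. *)
have KE : k = K - K * q by rewrite /K; field; rewrite gt_eqF.
have QE : q = Q - Q * q by rewrite /Q; field; rewrite gt_eqF.
clearbody K Q.
(* A state is a triple [(x, y, z)]. The two inequalities in [good] reserve room in the balls for all
   later displacements. *)
pose gap (s : X * Y * Y) := `|s.2 - s.1.2|.
pose good (s : X * Y * Y) := [/\ F s.1.1 s.2, G s.1.1 (- s.1.2),
  `|s.1.1 - xb| + K * gap s < a & `|s.2 - yb| + Q * gap s < a].
pose step (s t : X * Y * Y) := [/\ t.1.2 = s.2, G t.1.1 (- s.2),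
  `|t.1.1 - s.1.1| <= k * gap s, `|t.2 - s.2| <= q * gap s &
  gap t <= q * gap s].
(* The reserve [K * gap] drops by at least the length of the step. The centre [c] will be [xb], to
   stay in the ball, and [x0], for the final estimate. *)
have decr_x c s t : step s t ->
    `|t.1.1 - c| + K * gap t <= `|s.1.1 - c| + K * gap s.
  case=> _ _ hx _ hg; have := ler_distD s.1.1 t.1.1 c.
  by have := ler_wpM2l K0 hg; move: hx; rewrite {1}KE; lra.
have decr_z c s t : step s t ->
    `|t.2 - c| + Q * gap t <= `|s.2 - c| + Q * gap s.
  case=> _ _ _ hz hg; have := ler_distD s.2 t.2 c.
  by have := ler_wpM2l Q0 hg; move: hz; rewrite {1}QE; lra.
have ballN (V : normedModType R) (b v : V) e : e >= 0 -> `|v - b| + e < a ->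
    ball b a v.
  by move=> e0 h; rewrite -ball_normE /ball_ /= distrC; lra.
have gap0 s : 0 <= gap s by exact: normr_ge0.
(* Stated for every state so that [choice] yields a total function; states that are not good may go
   anywhere. *)
have next s : exists t, good s -> good t /\ step s t.
  have [[Fs Gs hx hz]|nogood] := pselect (good s); last by exists s.
  have Bx := ballN _ _ _ _ (mulr_ge0 K0 (gap0 s)) hx.
  have Bz := ballN _ _ _ _ (mulr_ge0 Q0 (gap0 s)) hz.
  have [u Gu ux] := stepG _ _ _ Bx Bz Gs.
  have Bu : ball xb a u.
    apply: (ballN _ _ _ 0) => //; rewrite addr0.
    have := ler_distD s.1.1 u xb; rewrite -/(gap s) in ux.
    have Kq : 0 <= K * q * gap s by rewrite !mulr_ge0 // ltW.
    by move: ux; rewrite KE; lra.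
  have [w Fw wz] := stepF _ _ _ Bx Bu Bz Fs.
  have wq : `|w - s.2| <= q * gap s.
    apply: (le_trans wz); rewrite /q (mulrC k) -mulrA.
    by rewrite ler_wpM2l // ltW.
  exists (u, s.2, w) => _.
  have st : step s (u, s.2, w) by split.
  split => //; split => //=.
  - exact: le_lt_trans (decr_x xb _ _ st) hx.
  - exact: le_lt_trans (decr_z yb _ _ st) hz.
have [f fP] := choice next.
pose s n := iter n f (x0, y0, z0).
have gs n : good (s n).
  elim: n => [|n /fP[]//]; by split.
have ss n : step (s n) (s n.+1) by have [] := fP _ (gs n).
have gapn n : gap (s n) <= gap (s 0%N) * q ^+ n.
  elim: n => [|n IH]; first by rewrite expr0 mulr1.
  have [_ _ _ _ h] := ss n; apply: (le_trans h).
  by rewrite exprS mulrCA ler_wpM2l // ltW.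
have qI : 0 <= q < 1 by rewrite ltW.
have cx : cvgn (fun n => (s n).1.1).
  apply: (@cvgn_geometric_step _ _ _ (k * gap (s 0%N)) q) => //.
    by rewrite mulr_ge0 // ltW.
  move=> n; have [_ _ h _ _] := ss n; apply: (le_trans h).
  by rewrite -mulrA ler_wpM2l // ltW.
have cz : cvgn (fun n => (s n).2).
  apply: (@cvgn_geometric_step _ _ _ (q * gap (s 0%N)) q) => //.
    by rewrite mulr_ge0 // ltW.
  move=> n; have [_ _ _ h _] := ss n; apply: (le_trans h).
  by rewrite -mulrA ler_wpM2l // ltW.
have bx n : cball xb a (s n).1.1.
  have [_ _ h _] := gs n; have := mulr_ge0 K0 (gap0 (s n)).
  by rewrite /cball /closed_ball_ /= distrC; lra.
have bz n : cball yb a (s n).2.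
  have [_ _ _ h] := gs n; have := mulr_ge0 Q0 (gap0 (s n)).
  by rewrite /cball /closed_ball_ /= distrC; lra.
set u := limn (fun n => (s n).1.1); set w := limn (fun n => (s n).2).
(* [step] places [- (s n).2] in [G] at the next point [(s n.+1).1.1], so the graph of [G] is
   followed along the shifted sequence, which has the same limit [u]. *)
have cxS : (s n.+1).1.1 @[n --> \oo] --> u.
  by have := cx; rewrite -cvg_shiftS.
exists u, w; split.
- have [] // : (graph F `&` (cball xb a `*` cball yb a)) (u, w).
  have cxz : ((s n).1.1, (s n).2) @[n --> \oo] --> (u, w) by exact: cvg_pair cx cz.
  refine (closed_cvg _ clF _ _ cxz).
  apply: nearW => n; split; last by split; [exact: bx|exact: bz].
  by have [] := gs n.
- have [] // : (graph G `&` (cball xb a `*` cball (- yb) a)) (u, - w).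
  have cxz : ((s n.+1).1.1, - (s n).2) @[n --> \oo] --> (u, - w).
    exact: cvg_pair cxS (cvgN cz).
  refine (closed_cvg _ clG _ _ cxz).
  apply: nearW => n; split; first by have [] := ss n.
  split; first exact: bx.
  by rewrite /cball /closed_ball_ /= -opprD normrN; exact: bz.
(* The potential centred at [x0] never increases and starts at [K * gap (s 0%N)]. *)
- have cd : `|(s n).1.1 - x0| @[n --> \oo] --> `|u - x0|.
    by apply: cvg_norm; apply: cvgB => //; exact: cvg_cst.
  rewrite -(cvg_lim _ cd) //; apply: limr_le; first by apply: cvgP cd.
  apply: nearW => n; apply: (@le_trans _ _ (`|(s n).1.1 - x0| + K * gap (s n))).
    by rewrite lerDl mulr_ge0.
  elim: n => [|n IH]; first by rewrite /= subrr normr0 add0r.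
  exact: le_trans (decr_x _ _ _ (ss n)) IH.
Qed.

(** * Distances, excesses and near-optimal points *)

(** The infimum may not be attained: for [t > 0] the slack [L0 < L] supplies a point, while for
    [t = 0] there is no slack and [x] itself serves. *)
Lemma dist_set_witness (R : realType) (V : normedModType R) (x : V) (A : set V)
    (L0 L t : R) :
  L0 < L -> 0 <= t -> (t = 0 -> A x) -> (dist_set x A <= (L0 * t)%:E)%E ->
  exists2 a, A a & `|a - x| <= L * t.
Proof.
move=> LL; rewrite le_eqVlt => /orP[/eqP<- Ax _|t0 _ dA].
  by exists x; [exact: Ax|rewrite subrr normr0 mulr0].
have : (dist_set x A < (L * t)%:E)%E.
  by apply: le_lt_trans dA _; rewrite lte_fin ltr_pM2r.
case/ereal_inf_lt => _ [a Aa <-]; rewrite lte_fin distrC => /ltW ax.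
by exists a.
Qed.

Lemma dist_set_le_norm (R : realType) (V : normedModType R) (x a : V) (A : set V) :
  A a -> (dist_set x A <= `|x - a|%:E)%E.
Proof. by move=> Aa; apply: ereal_inf_lbound; exists a. Qed.

Lemma dist_set_le_excess (R : realType) (V : normedModType R) (A B : set V) (a : V) :
  A a -> (dist_set a B <= excess A B)%E.
Proof.
move=> Aa; rewrite /excess ifF; first by apply: ereal_sup_ubound; exists a.
by apply/negbTE/set0P; exists a.
Qed.

(** The bound [0 <= c] covers the empty [A], whose excess is 0 by convention. *)
Lemma excess_le (R : realType) (V : normedModType R) (A B : set V) (c : R) :
  0 <= c -> (forall a, A a -> (dist_set a B <= c%:E)%E) ->
  (excess A B <= c%:E)%E.
Proof.
move=> c0 h; rewrite /excess; case: ifP => // _.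
by apply: ge_ereal_sup => _ [a Aa <-]; exact: h.
Qed.

(** * Small radii and closed boxes *)

Lemma near_mul_le (R : realType) (C b : R) : 0 < C -> 0 < b ->
  \forall e \near 0^'+, C * e <= b.
Proof.
move=> C0 b0; near=> e; rewrite mulrC -ler_pdivlMr //; near: e.
by apply: nbhs_right_le; rewrite divr_gt0.
Unshelve. all: by end_near. Qed.

Lemma near_ball_subset (R : realType) (V : normedModType R) (x : V) (U : set V) :
  nbhs x U -> \forall a \near 0^'+, ball x a `<=` U.
Proof.
case/nbhs_ballP => e /= e0 xeU; near=> a.
apply: subset_trans xeU; apply: le_ball; near: a; exact: nbhs_right_le.
Unshelve. all: by end_near. Qed.

Lemma closed_setX (S T : topologicalType) (A : set S) (B : set T) :
  closed A -> closed B -> closed (A `*` B).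
Proof.
move=> clA clB; apply: (@closedI _ (fst @^-1` A) (snd @^-1` B)).
- by apply: preimage_closed clA => x _; exact: cvg_fst.
- by apply: preimage_closed clB => x _; exact: cvg_snd.
Qed.

(** A box of radius at most [r / 2] lies inside the additive ball of radius [r]. *)
Lemma locally_closed_box (R : realType) (X Y : normedModType R)
    (A : set (X * Y)) (x : X) (y : Y) :
  locally_closed_around A (x, y) ->
  \forall a \near 0^'+, closed (A `&` (cball x a `*` cball y a)).
Proof.
case=> r [r0 clA]; near=> a.
rewrite (_ : _ `&` _ =
    (A `&` add_cball (x, y) r) `&` (cball x a `*` cball y a)); last first.
  apply/seteqP; split=> [[u v] [Auv [/= xu yv]]|[u v] [[Auv _] uv]] //.
  split=> //; split=> //; rewrite /add_cball /=.
  have : a <= r / 2 by near: a; apply: nbhs_right_le; rewrite divr_gt0.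
  by move: xu yv; rewrite /cball /closed_ball_ /=; lra.
by apply: closedI => //; apply: closed_setX; exact: closed_closed_ball_.
Unshelve. all: by end_near. Qed.

(** * Calmness with explicit constants *)

(** The strict inequalities [l0 < l], [k0 < k], [c0 < c] are the slack that turns bounds on
    distances into actual points. *)
Lemma calm_const_solution_map (R : realType) (X Y P : completeNormedModType R)
    (F : X * P -> set Y) (G : X -> set Y) (xb : X) (pb : P) (yb : Y)
    (l0 l k0 k c0 c : R) :
  locally_sum_stable F G xb pb yb (- yb) ->
  locally_closed_graphs_unif F xb pb yb ->
  locally_closed_around (graph G) (xb, - yb) ->
  aubin_x_const F xb pb yb l0 -> calm_p_const F xb pb yb c0 ->
  metrically_regular_const G xb (- yb) k0 ->
  l0 < l -> k0 < k -> c0 < c -> k * l < 1 ->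
  calm_const (solution_map F G) pb xb (k * c / (1 - k * l)).
Proof.
move=> stable [g [g0 clF]] clG [l00 [U1 [V1 [W1 [xU1 pV1 yW1 aubin]]]]].
move=> [c00 [U2 [V2 [W2 [xU2 pV2 yW2 calmF]]]]] [k00 [U3 [W3 [xU3 yW3 regG]]]].
move=> l0l k0k c0c kl1.
have k_gt0 := lt_trans k00 k0k; have l_gt0 := lt_trans l00 l0l.
have c_gt0 := lt_trans c00 c0c.
have d_gt0 : 0 < 1 - k * l by rewrite subr_gt0.
set K := k / (1 - k * l); have K0 : 0 < K by rewrite divr_gt0.
have Q0 : 0 <= k * l / (1 - k * l) by rewrite divr_ge0 ?mulr_ge0 ?ltW.
have KE : k * c / (1 - k * l) = K * c by rewrite /K mulrAC.
rewrite KE; split; first exact: mulr_gt0.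
(* A single radius [a] on which all the local hypotheses hold. *)
have : \forall a \near (0 : R)^'+,
  [/\ ball xb a `<=` U1, ball xb a `<=` U2, ball xb a `<=` U3, 
   ball yb a `<=` W1 & ball yb a `<=` W2] /\
  [/\ ball (- yb) a `<=` W3, a <= g, 0 < a &
    closed (graph G `&` (cball xb a `*` cball (- yb) a))].
  near=> a; split; split; near: a; try exact: near_ball_subset.
  - exact: nbhs_right_le.
  - exact: nbhs_right_gt.
  - exact: locally_closed_box.
case/filter_ex => a [[aU1 aU2 aU3 aW1 aW2] [aW3 ag a0 clGa]].
have clFa : closed (graph (slice F pb) `&` (cball xb a `*` cball yb a)).
  rewrite (_ : _ `&` _ = (graph (slice F pb) `&` (cball xb g `*` cball yb g)) `&`
      (cball xb a `*` cball yb a)); last first.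
    apply/seteqP; split=> [[u v] [Fuv [/= xu yv]]|[u v] [[Fuv _] uv]] //.
    by split=> //; split=> //; split; [exact: le_trans xu ag|exact: le_trans yv ag].
  apply: closedI; first by apply: clF; exact: ballxx.
  by apply: closed_setX; exact: closed_closed_ball_.
have stepF x u y : ball xb a x -> ball xb a u -> ball yb a y ->
    slice F pb x y -> exists2 y', slice F pb u y' & `|y' - y| <= l * `|u - x|.
  move=> xx xu yy Fxy; apply: (dist_set_witness l0l) => //.
    by move/eqP; rewrite normr_eq0 subr_eq0 => /eqP ->.
  rewrite distrC; apply: le_trans (aubin x u pb (aU1 _ xx) (aU1 _ xu) _).
    by apply: dist_set_le_excess; split => //; exact: aW1.
  exact: nbhs_singleton.
have stepG x y z : ball xb a x -> ball yb a z -> G x (- y) ->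
    exists2 u, G u (- z) & `|u - x| <= k * `|z - y|.
  move=> xx yz Gxy.
  apply: (@dist_set_witness _ _ _ (inverse_map G (- z)) _ _ _ k0k) => //.
    by move/eqP; rewrite normr_eq0 subr_eq0 => /eqP ->.
  (* Metric regularity is applied at the target [- z], whose distance to [G x] is at most the norm
     of [z - y] because [- y] lies in [G x]. *)
  have W3z : W3 (- z).
    by apply: aW3; move: yz; rewrite -!ball_normE /ball_ /= -opprD normrN.
  apply: le_trans (regG _ _ (aU3 _ xx) W3z) _.
  rewrite EFinM lee_pmul2l ?lte_fin //.
  by have := dist_set_le_norm (- z) Gxy; rewrite -opprD normrN.
have coinc := coincidence_point k_gt0 l_gt0 kl1 clFa clGa stepF stepG.
have a20 : 0 < a / 2 by rewrite divr_gt0.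
have [d [d0 stab]] := stable _ a20.
(* The last two bounds make [(x, y, z)] an admissible start of the iteration: [x] and [y] are within
   [a / 2] of [xb] and [yb], and the gap is at most [c * e]. *)
have : \forall e \near (0 : R)^'+, [/\ ball pb e `<=` V2, e <= d, 0 < e,
    (K * c) * e <= a / 2 & (c + k * l / (1 - k * l) * c) * e <= a / 2].
  near=> e; split; near: e.
  - exact: near_ball_subset.
  - exact: nbhs_right_le.
  - exact: nbhs_right_gt.
  - by apply: near_mul_le => //; exact: mulr_gt0.
  - by apply: near_mul_le => //; rewrite ltr_pwDl // mulr_ge0 // ltW.
case/filter_ex => e [eV2 ed e0 ex ez].
exists (ball pb e), (ball xb (Order.min d (a / 2))); split.
- exact: nbhsx_ballx.
- by apply: nbhsx_ballx; rewrite lt_min d0.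
move=> p pe; apply: excess_le; first by rewrite mulr_ge0 // ltW // mulr_gt0.
move=> x [Sx xd].
have xd1 : ball xb d x by apply: le_ball xd; rewrite ge_min lexx.
have xa2 : ball xb (a / 2) x by apply: le_ball xd; rewrite ge_min lexx orbT.
have aa : a / 2 <= a by lra.
have xa : ball xb a x by exact: le_ball xa2.
(* Sum-stability at [w = 0], which is the centre [yb + - yb] itself. *)
have [|y [y' [Fy yy Gy' _ /esym /eqP]]] := stab x p xd1 (le_ball ed pe) 0 Sx.
  by rewrite subrr; exact: ballxx.
rewrite addrC addr_eq0 => /eqP y'E; rewrite {}y'E in Gy'.
have [z Fz zy] : exists2 z, F (x, pb) z & `|z - y| <= c * `|p - pb|.
  apply: (dist_set_witness c0c) => //.
    by move/eqP; rewrite normr_eq0 subr_eq0 => /eqP <-.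
  apply: le_trans (calmF x p (aU2 _ xa) (eV2 _ pe)).
  by apply: dist_set_le_excess; split => //; apply: aW2; exact: le_ball yy.
have pe' : `|p - pb| <= e.
  by move: pe; rewrite -ball_normE /ball_ /= distrC => /ltW.
have zce : `|z - y| <= c * e by apply: le_trans zy _; rewrite ler_pM2l.
move: xa2 yy; rewrite -!ball_normE /ball_ /= !(distrC _ x) !(distrC _ y) => xa2 yy.
have [||u [w [Fw Gw ux]]] := coinc x y z Fz Gy'.
- by have := ler_wpM2l (ltW K0) zce; rewrite -/K; lra.
- have := ler_distD y z yb; have := ler_wpM2l Q0 zce; lra.
have Su : solution_map F G pb u by exists w => //; exists (- w) => //; rewrite subrr.
apply: le_trans (dist_set_le_norm _ Su) _; rewrite lee_fin distrC.
by apply: le_trans ux _; rewrite -/K -(mulrA K) ler_pM2l.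
Unshelve. all: by end_near. Qed.

(** * Passage to the infima of the constants *)

(** Positivity bounds the infimum below and any element bounds it above, so it is finite. It may be
    0 or unattained, hence the margin [e]. *)
Lemma ereal_inf_positive_constants (R : realType) (A : set R) :
  A !=set0 -> (forall L, A L -> 0 < L) ->
  exists2 r : R, ereal_inf [set L%:E | L in A] = r%:E &
    forall e, 0 < e -> exists2 L, A L & L < r + e.
Proof.
move=> [L0 AL0] A0.
have i0 : (0 <= ereal_inf [set L%:E | L in A])%E.
  by apply: le_ereal_inf_tmp => _ [L AL <-]; rewrite lee_fin ltW // A0.
have iL : (ereal_inf [set L%:E | L in A] <= L0%:E)%E.
  by apply: ereal_inf_lbound; exists L0.
have ifin : ereal_inf [set L%:E | L in A] \is a fin_num.
  by rewrite ge0_fin_numE //; apply: le_lt_trans iL (ltry _).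
exists (fine (ereal_inf [set L%:E | L in A])); first by rewrite fineK.
move=> e e0.
have : (ereal_inf [set L%:E | L in A] <
        (fine (ereal_inf [set L%:E | L in A]) + e)%:E)%E.
  by rewrite EFinD fineK // lteDl.
by case/ereal_inf_lt => _ [L AL <-]; rewrite lte_fin => Le; exists L.
Qed.

Theorem theorem3p16 (R : realType) (X Y P : completeNormedModType R)
    (F : X * P -> set Y) (G : X -> set Y) (xb : X) (pb : P) (yb : Y)
    (hF : F (xb, pb) yb) (hG : G xb (- yb))
    (h_sum_stable : locally_sum_stable F G xb pb yb (- yb))
    (h_closedF : locally_closed_graphs_unif F xb pb yb)
    (h_closedG : locally_closed_around (graph G) (xb, - yb))
    (h_aubin : aubin_x F xb pb yb)
    (h_calm : calm_p F xb pb yb)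
    (h_reg : metrically_regular G xb (- yb))
    (h_lt1 : (lip_x F xb pb yb * reg G xb (- yb)%R < 1)%E) :
  calm (solution_map F G) pb xb /\
  (clm (solution_map F G) pb xb <=
     (reg G xb (- yb)%R * clm_p F xb pb yb) /
       (1 - lip_x F xb pb yb * reg G xb (- yb)%R))%E.
Proof.
have [l lE lA] := ereal_inf_positive_constants h_aubin (fun _ => @proj1 _ _).
have [c cE cA] := ereal_inf_positive_constants h_calm (fun _ => @proj1 _ _).
have [r rE rA] := ereal_inf_positive_constants h_reg (fun _ => @proj1 _ _).
rewrite /lip_x /reg /clm_p lE cE rE in h_lt1 *.
move: h_lt1; rewrite -EFinM lte_fin => lr1.
(* The calmness constant of [S] obtained when each of the three infima is enlarged by [e]. *)
pose h e := (r + e) * (c + e) / (1 - (r + e) * (l + e)).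
have cid (s : R) : s + e @[e --> 0^'+] --> s.
  have e0 : e @[e --> (0 : R)^'+] --> (0 : R) by exact: cvg_at_right_filter.
  have : s + e @[e --> (0 : R)^'+] --> s + 0 by apply: cvgD e0; exact: cvg_cst.
  by rewrite addr0.
have crl : (r + e) * (l + e) @[e --> (0 : R)^'+] --> r * l.
  exact: cvgM (cid r) (cid l).
have rl_lt1 : \forall e \near (0 : R)^'+, (r + e) * (l + e) < 1.
  by apply: (cvgr_lt (r * l) crl 1); rewrite mulrC.
have rl1 : 1 - r * l != 0 by rewrite gt_eqF // subr_gt0 mulrC.
have hcvg : h e @[e --> 0^'+] --> r * c / (1 - r * l).
  apply: cvgM; first exact: cvgM (cid r) (cid c).
  by apply: cvgV => //; apply: cvgB; [exact: cvg_cst|exact: crl].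
have hcalm : \forall e \near 0^'+, calm_const (solution_map F G) pb xb (h e).
  near=> e.
  have e0 : 0 < e by [].
  have [l1 l1A l1e] := lA _ e0; have [c1 c1A c1e] := cA _ e0.
  have [r1 r1A r1e] := rA _ e0.
  apply: (calm_const_solution_map h_sum_stable h_closedF h_closedG l1A c1A r1A) => //.
  near: e; exact: rl_lt1.
have hS : calm (solution_map F G) pb xb.
  by have [e he] := filter_ex hcalm; exists (h e).
split=> //.
have [s sE _] := ereal_inf_positive_constants hS (fun _ => @proj1 _ _).
(* The extended inverse of a real is its real inverse only away from 0; here [l * r < 1] gives
   this. *)
rewrite /clm sE -EFinB inver subr_eq0 eq_sym lt_eqF // -EFinM lee_fin (mulrC l).
(* The infimum [s] is below [h e] for all small [e > 0], hence below the limit. *)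
rewrite -(cvg_lim _ hcvg) //; apply: limr_ge; first by apply: cvgP hcvg.
near=> e.
rewrite -lee_fin -sE; apply: ereal_inf_lbound; exists (h e) => //; near: e.
exact: hcalm.
Unshelve. all: by end_near. Qed.
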